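(* Let $p$ be a prime and let $2\leq q\leq p$. Suppose that $X$ is a free $\mathbb{Z}_p$-space and let $n_q=\mathrm{ind}_q(X,\mathbb{Z}_p)$. Then \[\mathrm{secat}(X\to X/\mathbb{Z}_p)\leq n_q(p-1)+q-1\] (where the right-hand side is understood as $\infty$ if $n_q=\infty$).
   Context: ''Space'' means topological space and ''map'' means continuous map. For a finite group $G$, a free $G$-space is a Hausdorff space $X$ on which $G$ acts freely on the left; $X\to X/G$ denotes the quotient map (a fibration). $\mathbb{Z}_p$ is the cyclic group of order $p$. For a finite group $G$ of order $\ell$, $2\leq q\leq\ell$, and a space $Y$, the configuration-like space $F(Y,\ell,q)\subset Y^\ell$ (subspace topology) is the set of all $(y_1,\ldots,y_\ell)\in Y^\ell$ such that for any indices $0<i_1<\cdots<i_q\leq\ell$ at least two of $y_{i_1},\ldots,y_{i_q}$ are different. Fix an enumeration $G=\{g_1,\ldots,g_\ell\}$ and let $h:G\to\{1,\ldots,\ell\}$ be the bijection $h(g_j)=j$. The group $G$ acts on the left on $Y^\ell$ by $g(y_1,\ldots,y_\ell)=(y_{h(g^{-1}g_1)},\ldots,y_{h(g^{-1}g_\ell)})$, and this restricts to a left action on $F(Y,\ell,q)$. The $q$-th index $\mathrm{ind}_q(X,G)$ of a free $G$-space $X$ is the least integer $k\in\{0,1,2,\ldots\}$ such that there exists a $G$-equivariant map $X\to F(\mathbb{R}^{k+1},\ell,q)$, and $\mathrm{ind}_q(X,G)=\infty$ if no such $k$ exists. For a fibration $\pi:E\to B$, the sectional category $\mathrm{secat}(\pi)$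 is the minimal cardinality of an open cover of $B$ such that each element $U$ of the cover admits a local section of $\pi$ (a map $s:U\to E$ with $\pi\circ s$ equal to the inclusion $U\hookrightarrow B$); $\mathrm{secat}(\pi)=\infty$ if no such finite cover exists. *)

(* Defs.v *)
From HB Require Import structures.
From mathcomp Require Import all_boot all_order all_algebra all_fingroup all_solvable.
From mathcomp Require Import all_classical all_reals all_analysis.
Set Implicit Arguments.
Unset Strict Implicit.
Unset Printing Implicit Defensive.
Import Order.TTheory GRing.Theory Num.Theory.
Import numFieldNormedType.Exports.
Local Open Scope classical_set_scope.

(* The least element of [set n | P n], with value +oo if there is none. *)
Definition least (P : set nat) : \bar int :=
  if pselect (exists n, `[< P n >]) is left exP
  then (Posz (ex_minn exP))%:E else +oo%E.

(* The library's [action] is a right action, hence this record. *)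
Record freeGSpace (gT : finGroupType) := FreeGSpace {
  carrier :> topologicalType;
  lact : gT -> carrier -> carrier;
  lact1 : forall x, lact 1%g x = x;
  lactM : forall a b x, lact (a * b)%g x = lact a (lact b x);
  lact_continuous : forall a, continuous (lact a);
  lact_free : forall a x, lact a x = x -> a = 1%g;
  carrier_hausdorff : hausdorff_space carrier }.

Section OrbitSpace.
Variables (gT : finGroupType) (X : freeGSpace gT).

Definition orbit_rel (x y : X) : bool := `[< exists a : gT, lact a x = y >].

Lemma orbit_rel_equiv : equiv_class_of orbit_rel.
Proof.
split=> [x|x y|y x z].
- by apply/asboolP; exists 1%g; rewrite lact1.
- by apply/asboolP/asboolP => -[a <-]; exists a^-1%g;
    rewrite -lactM mulVg lact1.
- move=> /asboolP[a <-] /asboolP[b <-]; apply/asboolP; exists (b * a)%g.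
  by rewrite lactM.
Qed.

Definition orbit_equiv : equiv_rel X := EquivRelPack orbit_rel_equiv.

Definition orbit_space : topologicalType :=
  quotient_topology {eq_quot orbit_equiv}%qT.

Definition orbit_map : X -> orbit_space := \pi_({eq_quot orbit_equiv})%qT.

End OrbitSpace.

Section Secat.
Variables (E B : topologicalType) (f : E -> B).

(* [U] is used as a type, which carries the subspace topology of [B]. *)
Definition has_local_section (U : set B) : Prop :=
  exists s : U -> E, continuous s /\ forall u : U, f (s u) = \val u.

Definition sectional_cover (C : set (set B)) : Prop :=
  [/\ \bigcup_(U in C) U = setT,
      forall U, C U -> open U &
      forall U, C U -> has_local_section U].

Definition secat : \bar int :=
  least [set m | exists2 C, sectional_cover C & (C #= `I_m)%card].

End Secat.

(* Indices run over {0, ..., l-1}; [{ptws 'I_l -> Y}] has the product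
   topology. *)
Definition config (Y : topologicalType) (l q : nat) : set {ptws 'I_l -> Y} :=
  [set y | forall i : 'I_q -> 'I_l, {homo i : a b / (a < b)%N} ->
     exists a b : 'I_q, y (i a) <> y (i b)].
Arguments config : clear implicits.

Definition tuple_act (gT : finGroupType) (l : nat)
    (g : 'I_l -> gT) (h : gT -> 'I_l) (Y : topologicalType)
    (a : gT) (y : {ptws 'I_l -> Y}) : {ptws 'I_l -> Y} :=
  fun j => y (h (a^-1 * g j)%g).

(* [g] enumerates the group and [h] is the inverse bijection. *)
Definition qindex (R : realType) (gT : finGroupType) (X : freeGSpace gT)
    (l : nat) (g : 'I_l -> gT) (h : gT -> 'I_l) (q : nat) : \bar int :=
  least [set k | exists f : X -> config 'rV[R]_k.+1 l q,
    continuous f /\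
    forall a x, \val (f (lact a x)) = tuple_act g h a (\val (f x))].

(* Main.v *)
Require Import Defs.
From HB Require Import structures.
From mathcomp Require Import all_boot all_order all_algebra all_fingroup all_solvable.
From mathcomp Require Import all_classical all_reals all_analysis.
From mathcomp Require Import zify.

(** Let [f : X -> F(R^(k+1), p, q)] be equivariant, and regard [f x] as a family
    of points indexed by the group.  For a coordinate [c] and [0 < j < p], let
    [U c j] be the open invariant set of those [x] for which the [j] smallest
    values of the [c]-th coordinate are well defined, i.e. attained on a set
    [A] of [j] group elements and strictly smaller than the values off [A].
    Then [A] is unique, locally constant and equivariant in [x]; since [p] is
    prime, the group acts freely on its proper nonempty subsets, so that
    restricting [A] to a transversal of this action yields a slice, hence a
    local section over [U c j / G].  The sets with [c < k] contain every [x]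
    with a nonconstant coordinate [c < k].  If the coordinates [c < k] are all
    constant, then fewer than [q] points attain the minimum of the last
    coordinate, so that [U k j] with [j < q] suffice: altogether
    [k (p - 1) + (q - 1)] sets. *)

Set Implicit Arguments.
Unset Strict Implicit.
Unset Printing Implicit Defensive.
Import Order.TTheory GRing.Theory Num.Theory.
Import numFieldNormedType.Exports.
Local Open Scope classical_set_scope.

(** * Upper bounds for [least] and [secat] *)

Lemma least_le (P : set nat) (m n : nat) :
  P m -> (m <= n)%N -> (least P <= (Posz n)%:E)%E.
Proof.
move=> Pm mn; rewrite /least; case: pselect => [exP|[]]; last first.
  by exists m; apply/asboolP.
case: ex_minnP => l _ /(_ m) lP; rewrite lee_fin lez_nat.
by apply: leq_trans mn; apply: lP; apply/asboolP.
Qed.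

Lemma leastP (P : set nat) :
  (exists2 n, P n & least P = (Posz n)%:E) \/ least P = +oo%E.
Proof.
rewrite /least; case: pselect => [exP|_]; last by right.
by left; case: ex_minnP => l /asboolP Pl _; exists l.
Qed.

(** The sets [W i] may repeat, so the cover has some cardinality [m <= n]; this is why [least_le]
    leaves room between the two. *)
Lemma secat_le (E B : topologicalType) (f : E -> B) (n : nat)
    (W : nat -> set B) :
  (forall b, exists2 i, (i < n)%N & W i b) ->
  (forall i, open (W i)) -> (forall i, has_local_section f (W i)) ->
  (secat f <= (Posz n)%:E)%E.
Proof.
move=> Wcover Wopen Wsec.
have /finite_setP[m Wm] : finite_set (W @` `I_n).
  exact: finite_image (finite_II n).
apply: (@least_le _ m).
  exists (W @` `I_n) => //; split=> [|U [i _ <-]//|U [i _ <-]//].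
  rewrite -subTset => b _; have [i ilt Wib] := Wcover b.
  by exists (W i) => //; exists i.
rewrite -card_le_II.
by rewrite -(card_le_eql Wm); exact: card_image_le.
Qed.

(** * Local sections of the orbit map from slices *)

Section OrbitMap.
Variables (gT : finGroupType) (X : freeGSpace gT).

Lemma orbit_mapP (x y : X) :
  orbit_map x = orbit_map y <-> exists a, lact a x = y.
Proof.
split=> [/eqmodP /asboolP //|xy]; exact/eqmodP/asboolP.
Qed.

Lemma orbit_map_open (O : set X) : open O -> open (@orbit_map gT X @` O).
Proof.
move=> oO.
(* Openness in the quotient topology is by definition openness of the preimage, here a union of
   translates of [O]. *)
suff : open (@orbit_map gT X @^-1` (@orbit_map gT X @` O)) by [].
have -> : @orbit_map gT X @^-1` (@orbit_map gT X @` O) =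
    \bigcup_(a in [set: gT]) (lact a @^-1` O).
  apply/seteqP; split=> [x [y Oy /esym/orbit_mapP[a axy]]|x [a _ Oax]].
    by exists a => //=; rewrite axy.
  by exists (lact a x) => //; apply/esym/orbit_mapP; exists a.
apply: bigcup_open => a _.
by move/continuousP: (@lact_continuous _ X a); exact.
Qed.

(** The section inverts [orbit_map] on [S]. It is continuous because [orbit_map] is open: the
    preimage of [O] is the trace of the image of the part of [O] in [S]. *)
Lemma slice_section (S : set X) : open S ->
  (forall x y, S x -> S y -> orbit_map x = orbit_map y -> x = y) ->
  has_local_section (@orbit_map gT X) (@orbit_map gT X @` S).
Proof.
move=> oS injS.
set W := @orbit_map gT X @` S.
have sP (w : W) : exists x, S x /\ orbit_map x = \val w.
  by case: w => w /= /set_mem [x Sx <-]; exists x.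
have [s sS] := choice sP.
exists s; split=> [|w]; last by have [] := sS w.
apply/continuousP => O oO.
exists (@orbit_map gT X @` (O `&` S)).
  by apply: orbit_map_open; exact: openI.
apply/seteqP; split=> [w [x [Ox Sx] xw]|w Osw].
  have [Ssw swE] := sS w.
  suff xsw : x = s w by rewrite /= -xsw.
  by apply: injS => //; rewrite swE.
by have [Ssw swE] := sS w; exists (s w).
Qed.

End OrbitMap.

(** * Left translation of subsets of the group *)

Section SubsetAction.
Variable gT : finGroupType.
Implicit Types (A B : {set gT}) (a : gT).
Local Open Scope group_scope.

(** In prime order a nontrivial [a] generates the group, so a nonempty set fixed by [a] is fixed by
    all translations and is everything. *)
Lemma lcoset_fix_prime A a : prime #|[set: gT]%SET| ->
  A != finset.set0 -> A != [set: gT]%SET -> a *: A = A -> a = 1.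
Proof.
move=> pr /set0Pn[u uA] AT aA.
apply/eqP/negPn/negP => a1; case/negP: AT.
rewrite -finset.subTset; apply/fintype.subsetP => v _.
have anA n : a ^+ n *: A = A.
  elim: n => [|n IHn]; first by rewrite expg0 lcoset1.
  by rewrite expgSr lcosetM aA IHn.
have cyc : <[a]> = [set: gT]%SET.
  apply/eqP; rewrite eqEcard finset.subsetT /=.
  have : #[a] %| #|[set: gT]%SET| by apply: order_dvdG; rewrite inE.
  have/prime_nt_dvdP := pr => /[apply].
  by rewrite order_eq1 => /(_ a1) <-; rewrite /order.
have /cycleP[n vu] : v * u^-1 \in <[a]> by rewrite cyc inE.
by rewrite -(anA n) -vu mem_lcoset invMg invgK mulgKV.
Qed.

Lemma lcoset_transversal : exists T : {set {set gT}},
  (forall A, exists a, a *: A \in T) /\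
  (forall A a, A \in T -> a *: A \in T -> a *: A = A).
Proof.
pose r A := odflt A [pick B | [exists a, B == a *: A]].
have rE A : exists a, r A = a *: A.
  rewrite /r; case: pickP => [B /existsP[a /eqP ->]|_]; first by exists a.
  by exists 1; rewrite lcoset1.
have rJ A a : r (a *: A) = r A.
  rewrite /r.
  rewrite (@eq_pick _ _ [pred B | [exists b, B == b *: A]]); last first.
    move=> B /=; apply/existsP/existsP => -[b /eqP ->].
      by exists (b * a); rewrite lcosetM.
    by exists (b * a^-1); rewrite -lcosetM mulgKV.
  (* The defaults [A] and [a *: A] may differ, but are never reached: [A] lies in its own orbit. *)
  case: pickP => // /(_ A) /existsP[]; exists 1; by rewrite lcoset1.
exists [set A | r A == A]%SET; split=> [A|A a].
  by have [a rA] := rE A; exists a; rewrite inE rJ rA.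
by rewrite !inE rJ => /eqP -> /eqP.
Qed.

End SubsetAction.

(** * Sets of smallest values of a coordinate *)

Section InitialSegments.
Variables (R : realType) (gT : finGroupType) (X : freeGSpace gT) (k : nat).
Variable z : X -> gT -> 'rV[R]_k.+1.
Hypothesis z_cont : forall u, continuous (z ^~ u).
Hypothesis z_equiv : forall a x u, z (lact a x) u = z x (a^-1 * u)%g.

Definition initial (c : 'I_k.+1) (A : {set gT}) : set X :=
  [set x | forall u v, u \in A -> v \notin A ->
    (z x u ord0 c < z x v ord0 c)%R].

Lemma initial_open c A : open (initial c A).
Proof.
rewrite openE => x xA.
have zc_cont w : continuous (fun y : X => z y w ord0 c).
  move=> y.
  apply: (@continuous_comp _ _ _ (z ^~ w) (fun M : 'rV[R]_k.+1 => M ord0 c)).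
    exact: z_cont.
  exact: coord_continuous.
have : \forall y \near x, forall i : gT * gT, i.1 \in A -> i.2 \notin A ->
    (z y i.1 ord0 c < z y i.2 ord0 c)%R.
  apply: filter_forall => -[u v] /=.
  have [uA|_] := boolP (u \in A); last by near=> y.
  have [_|vA] := boolP (v \in A); first by near=> y.
  have sub_cont : continuous (fun y : X => (z y v ord0 c - z y u ord0 c)%R).
    by move=> y; apply: continuousB; exact: zc_cont.
  have /continuousP/(_ _ (@open_gt R 0%R)) := sub_cont.
  rewrite openE => /(_ x); rewrite /= subr_gt0 => /(_ (xA u v uA vA)).
  by apply: filterS => y /=; rewrite subr_gt0.
by apply: filterS => y yA u v; exact: (yA (u, v)).
Unshelve. all: by end_near. Qed.

Lemma initial_lact c A a x :
  initial c A x -> initial c (a *: A)%g (lact a x).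
Proof. by move=> xA u v; rewrite !mem_lcoset !z_equiv; exact: xA. Qed.

(** Otherwise there are [u] in [A] but not [B] and [v] in [B] but not [A], and each has a smaller
    coordinate than the other. *)
Lemma initial_inj c (A B : {set gT}) x : #|A| = #|B| ->
  initial c A x -> initial c B x -> A = B.
Proof.
move=> AB xA xB; apply/eqP; rewrite eqEcard AB leqnn andbT.
apply/fintype.subsetP => u uA; apply/negPn/negP => uB.
have /fintype.subsetPn[v vB vA] : ~~ (B \subset A).
  apply/negP => BA; move: uB.
  have /eqP -> : B == A by rewrite eqEcard BA AB leqnn.
  by rewrite uA.
have := lt_trans (xA u v uA vA) (xB v u vB uB).
by rewrite ltxx.
Qed.

(** Taking all minimisers makes the inequality off [A] strict; [A] is the whole group when the
    coordinate is constant. *)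
Lemma initial_argmin c x : exists A : {set gT},
  [/\ initial c A x, A != finset.set0 &
      forall u v, u \in A -> (z x u ord0 c <= z x v ord0 c)%R].
Proof.
pose m := [arg min_(u < 1%g) z x u ord0 c]%O.
have mP v : (z x m ord0 c <= z x v ord0 c)%R.
  by rewrite /m; case: arg_minP => // i _; exact.
exists [set u | z x u ord0 c == z x m ord0 c]%SET; split.
- move=> u v; rewrite !inE => /eqP -> vm.
  by rewrite lt_neqAle eq_sym vm mP.
- by apply/set0Pn; exists m; rewrite inE.
- by move=> u v; rewrite inE => /eqP ->.
Qed.

Hypothesis gT_prime : prime #|[set: gT]%SET|.

(** An element taking [x] to [y] takes [A] to [B] by uniqueness, hence fixes [A] by transversality,
    hence is trivial by primality. *)
Lemma initial_slice c (T : {set {set gT}}) j (x y : X) :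
  (forall A a, A \in T -> a *: A \in T -> a *: A = A)%g ->
  (0 < j < #|[set: gT]%SET|)%N ->
  (exists A : {set gT}, [/\ A \in T, #|A| = j & initial c A x]) ->
  (exists A : {set gT}, [/\ A \in T, #|A| = j & initial c A y]) ->
  orbit_map x = orbit_map y -> x = y.
Proof.
move=> TP /andP[j0 jG] [A [AT Aj xA]] [B [BT Bj yB]] /orbit_mapP[a axy].
have aAB : (a *: A)%g = B.
  apply: (@initial_inj c _ _ y) => //; first by rewrite card_lcoset Aj Bj.
  by rewrite -axy; exact: initial_lact.
have aA : (a *: A)%g = A by apply: TP => //; rewrite aAB.
rewrite -axy (lcoset_fix_prime gT_prime _ _ aA) ?lact1//.
  by rewrite -card_gt0 Aj.
by apply: contraTneq jG => AE; rewrite -Aj AE ltnn.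
Qed.

Lemma secat_initial_le (n : nat) (c : nat -> 'I_k.+1) (j : nat -> nat) :
  (forall i, (0 < j i < #|[set: gT]%SET|)%N) ->
  (forall x, exists i (A : {set gT}),
     [/\ (i < n)%N, #|A| = j i & initial (c i) A x]) ->
  (secat (@orbit_map gT X) <= (Posz n)%:E)%E.
Proof.
move=> jP cover; have [T [T_ex T_uniq]] := lcoset_transversal gT.
pose S i := [set x : X | exists A : {set gT},
  [/\ A \in T, #|A| = j i & initial (c i) A x]].
have S_open i : open (S i).
  have -> : S i = \bigcup_(A in [set A : {set gT} | A \in T /\ #|A| = j i])
      initial (c i) A.
    by apply/seteqP; split=> [x [A [AT Aj xA]]|x [A [AT Aj] xA]]; exists A.
  by apply: bigcup_open => A _; exact: initial_open.
apply: (@secat_le _ _ _ n (fun i => @orbit_map gT X @` S i)).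
(* Moving [x] along its orbit brings its set [A] into [T]. *)
- move=> b; have [x <-] : exists x : X, orbit_map x = b.
    by exists (generic_quotient.repr b); exact: reprK.
  have [i [A [ilt Aj xA]]] := cover x; have [a aT] := T_ex A.
  exists i => //; exists (lact a x); last first.
    by apply/esym/orbit_mapP; exists a.
  exists (a *: A)%g; split=> //; first by rewrite card_lcoset.
  exact: initial_lact.
- by move=> i; exact: orbit_map_open.
- move=> i; apply: slice_section => // x y xS yS.
  exact: (initial_slice T_uniq (jP i) xS yS).
Qed.

End InitialSegments.

(** Otherwise the first [q] elements of [A], in increasing order, select [q] equal entries of
    [y]. *)
Lemma config_fiber_card (Y : topologicalType) (l q : nat)
    (y : {ptws 'I_l -> Y}) (A : {set 'I_l}) :
  config Y l q y -> (forall a b, a \in A -> b \in A -> y a = y b) ->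
  (#|A| < q)%N.
Proof.
move=> yP Ay; rewrite ltnNge; apply/negP => qA.
pose i (a : 'I_q) : 'I_l := enum_val (widen_ord qA a).
have [|a [b]] := yP i; last by apply; apply: Ay; exact: enum_valP.
have enum_sorted : sorted (fun u v : 'I_l => (u < v)%N) (enum A).
  rewrite /enum_mem; apply: sorted_filter => [u v w|]; first exact: ltn_trans.
  by have := iota_ltn_sorted 0 l; rewrite -val_enum_ord sorted_map enumT.
move=> a b ab; rewrite /i !(enum_val_nth (i a)).
apply: (sorted_ltn_nth _ (i a) enum_sorted) => //=.
- by move=> u v w; exact: ltn_trans.
- by rewrite inE -cardE; exact: leq_trans (ltn_ord a) qA.
- by rewrite inE -cardE; exact: leq_trans (ltn_ord b) qA.
Qed.

Local Close Scope classical_set_scope.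

Theorem theorem3p11 (R : realType) (p q : nat) (p_prime : prime p)
    (q_ge2 : (2 <= q)%N) (q_le_p : (q <= p)%N)
    (gT : finGroupType) (gT_cyclic : cyclic [set: gT])
    (gT_order : #|[set: gT]%SET| = p)
    (g : 'I_p -> gT) (h : gT -> 'I_p) (gK : cancel g h) (hK : cancel h g)
    (X : freeGSpace gT) :
  (secat (@orbit_map gT X) <=
     qindex R X g h q * (Posz (p - 1))%:E + (Posz (q - 1))%:E)%E.
Proof.
have p1 : (0 < p - 1)%N by rewrite subn_gt0 prime_gt1.
rewrite /qindex; set P := (X in least X).
have [[k [f [f_cont f_equiv]] ->]|->] := leastP P; last first.
  (* If the index is infinite, so is the right-hand side, as [p - 1] is positive. *)
  by rewrite gt0_mulye ?lte_fin ?ltz_nat// addye// leey.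
rewrite -EFinM -EFinD -PoszM -PoszD.
pose z (x : X) (u : gT) : 'rV[R]_k.+1 := \val (f x) (h u).
(* The pair [(c, j)] of the header is numbered [c * (p - 1) + (j - 1)]. *)
pose c i : 'I_k.+1 := inord (i %/ (p - 1)).
have z_cont u : continuous (z ^~ u).
  move=> x.
  apply: (@continuous_comp _ _ _ (fun x => \val (f x) : {ptws _ -> _})
    (@proj _ (fun=> 'rV[R]_k.+1) (h u))); last exact: proj_continuous.
  apply: (@continuous_comp _ _ _ f set_val); first exact: f_cont.
  exact: initial_continuous.
have z_equiv a x u : z (lact a x) u = z x (a^-1 * u)%g.
  by rewrite /z f_equiv /tuple_act hK.
have gT_prime : prime #|[set: gT]%SET| by rewrite gT_order.
apply: (secat_initial_le z_cont z_equiv gT_prime (c := c)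
  (j := fun i => (i %% (p - 1)).+1)) => [i|x].
  by rewrite gT_order /=; have := ltn_pmod i p1; lia.
have cE (d : 'I_k.+1) j : (j < p - 1)%N -> c (d * (p - 1) + j)%N = d.
  by move=> jp; rewrite /c divnMDl// divn_small// addn0 inord_val.
have jE (d : 'I_k.+1) j : (j < p - 1)%N -> ((d * (p - 1) + j) %% (p - 1))%N = j.
  by move=> jp; rewrite modnMDl modn_small.
have [d [A [xA A0 AT Alt]]] : exists (d : 'I_k.+1) (A : {set gT}),
    [/\ initial z d A x, A != finset.set0, A != [set: gT]%SET &
        d = k :> nat -> (#|A| < q)%N].
  have [[d [u [v duv]]]|cst] := pselect (exists (d : 'I_k.+1) u v,
      (z x u ord0 d < z x v ord0 d)%R /\ d != k :> nat).
    have [A [xA A0 Amin]] := initial_argmin z d x.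
    exists d, A; split=> //; last by move/eqP; case: duv => _ /negPf ->.
    apply/negP => /eqP AT; case: duv => + _.
    by rewrite ltNge Amin// AT inE.
  have z_const (d : 'I_k.+1) u v :
      d != k :> nat -> (z x u ord0 d <= z x v ord0 d)%R.
    by move=> dk; rewrite leNgt; apply/negP => vu; apply: cst; exists d, v, u.
  have [A [xA A0 Amin]] := initial_argmin z ord_max x.
  have Aq : (#|A| < q)%N.
    (* Minimisers of the last coordinate agree in all coordinates, so [f x] is constant on their
       images under [h]. *)
    rewrite -(card_imset _ (can_inj hK)).
    apply: (config_fiber_card (set_mem (svalP (f x)))).
    move=> _ _ /imsetP[u uA ->] /imsetP[v vA ->].
    apply/rowP => d; apply/le_anti.
    have [dk|dk] := eqVneq (val d) k.
      have -> : d = ord_max by exact: val_inj.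
      by rewrite Amin//= Amin.
    by rewrite !z_const.
  exists ord_max, A; split=> //.
  apply/negP => /eqP AT; move: Aq; rewrite AT gT_order.
  by rewrite ltnNge q_le_p.
have Ap : (#|A| < p)%N.
  by rewrite -gT_order proper_card// finset.properEneq AT finset.subsetT.
have A_gt0 : (0 < #|A|)%N by rewrite card_gt0.
have Ap1 : (#|A|.-1 < p - 1)%N by lia.
exists (d * (p - 1) + #|A|.-1)%N, A; rewrite cE// jE// prednK//; split=> //.
(* For [d = k] the offset [#|A|.-1] is below [q - 1]; for [d < k] the whole block of [p - 1] indices
   lies below [k * (p - 1)]. *)
have [dk|dk] := eqVneq (val d) k.
  by have := Alt dk; rewrite dk; lia.
have dk1 : (d < k)%N by rewrite ltn_neqAle dk -ltnS ltn_ord.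
have : (d.+1 * (p - 1) <= k * (p - 1))%N by rewrite leq_mul2r dk1 orbT.
by rewrite mulSn; lia.
Qed.
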